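(* Every unlabeled simple graph on at most four vertices is a Riordan graph.
   Context: Write $a\equiv b$ for congruence modulo $2$ and $[t^k]h$ for the coefficient of $t^k$ in a formal power series $h$. For $g,f\in\mathbb{Z}[[t]]$ (or $\mathbb{Z}_2[[t]]$) with $f(0)=0$ and $n\ge 1$, the Riordan graph $G_n(g,f)$ is the simple graph with vertex set $[n]=\{1,\dots,n\}$ in which, for $i>j\ge 1$, the vertices $i$ and $j$ are adjacent if and only if $[t^{i-2}]\,g f^{\,j-1}\equiv 1$ (with $f^0=1$). An unlabeled simple graph on $n$ vertices is called a Riordan graph if at least one of its labelings by $[n]$ is of the form $G_n(g,f)$, i.e. if it is isomorphic to some $G_n(g,f)$. Graphs have at least one vertex. *)

(* Defs.v *)
From mathcomp Require Import all_boot all_order all_algebra.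
Set Implicit Arguments.
Unset Strict Implicit.
Unset Printing Implicit Defensive.
Import GRing.Theory.

(* A formal power series over Z is its coefficient sequence: h k = [t^k] h. *)
Definition fps : Type := nat -> int.

Definition fps_one : fps := fun k => if k == 0%N then 1%R else 0%R.

Definition fps_mul (a b : fps) : fps :=
  fun k => (\sum_(i < k.+1) a i * b (k - i)%N)%R.

Definition fps_exp (a : fps) (m : nat) : fps := iter m (fps_mul a) fps_one.

(* Only meaningful for i > j >= 1, so neither subtraction is truncated where
   it is used below. *)
Definition riordan_odd (g f : fps) (i j : nat) : bool :=
  (fps_mul g (fps_exp f (j - 1)%N) (i - 2)%N == 1 %[mod 2])%Z.

(* The element u of 'I_n stands for the vertex u.+1 of {1, ..., n}. *)
Definition riordan_graph (n : nat) (g f : fps) : rel 'I_n :=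
  fun u v =>
    ((v < u) && riordan_odd g f u.+1 v.+1)
    || ((u < v) && riordan_odd g f v.+1 u.+1).

Definition simple_graph (V : finType) (e : rel V) : Prop :=
  symmetric e /\ irreflexive e.

Definition graph_isomorphic (V W : finType) (e : rel V) (e' : rel W) : Prop :=
  exists2 phi : V -> W,
    bijective phi & forall x y : V, e x y = e' (phi x) (phi y).

(* This predicate is invariant under isomorphism, hence a property of the
   unlabeled graph represented by e. *)
Definition is_riordan_graph (V : finType) (e : rel V) : Prop :=
  exists (n : nat) (g f : fps),
    [/\ 1 <= n, f 0 = 0%R & graph_isomorphic e (riordan_graph (n:=n) g f)].

(* Main.v *)
Require Import Defs.
From mathcomp Require Import all_boot all_order all_algebra.
From mathcomp Require Import zify.

Set Implicit Arguments.
Unset Strict Implicit.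
Unset Printing Implicit Defensive.

(** For g = g0 + g1 t + g2 t^2 and f = f1 t + f2 t^2 the graph G_4(g, f) has,
    modulo 2, the adjacencies
      12: g0,  13: g1,  14: g2,  23: g0 f1,  24: g0 f2 + g1 f1,  34: g0 f1.
    Hence a labelled graph on four vertices is of this form exactly when
    23 implies 12, 34 is equivalent to 23, and 24 implies 12 or 13: the entries
    12, 13, 14 determine g, and then f1, f2 can be solved for.  The lemma
    [realize_adjacencies] performs this solution.

    It remains to find a good order of the vertices ([riordan_order_exists]).
    A vertex of degree at most 1 can be put third with its neighbour, if any,
    first, so that 23 and 34 vanish, and the others can be ordered so that 24
    does no harm ([riordan_order_small_degree]).  If all degrees are at least 2,
    there is a Hamiltonian path ([hamiltonian_path4]), and following it makes
    12, 23 and 34 all present, which is a good order too.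

    On three vertices the only condition is that 23 implies 12, so it is enough
    to put an edge first if there is one; on at most two vertices every graph is
    obtained from g0 alone. *)

(** * Parities of the first coefficients *)

(** Only the parities of the coefficients matter for the graph, so 0 and 1 are
    coefficients enough. *)
Definition bit_series (s : seq bool) : fps :=
  fun k => if nth false s k then 1%R else 0%R.

(** The coefficients up to t^2 are finite expressions in the bits, so the table
    of adjacencies is checked by evaluating them on all 32 choices of bits. *)
Lemma riordan_odd_bits (g0 g1 g2 f1 f2 : bool) :
  let odd := riordan_odd (bit_series [:: g0; g1; g2])
                         (bit_series [:: false; f1; f2]) in
  [/\ odd 2 1 = g0, odd 3 1 = g1 & odd 4 1 = g2] /\
  [/\ odd 3 2 = g0 && f1, odd 4 2 = (g0 && f2) (+) (g1 && f1)
    & odd 4 3 = g0 && f1].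
Proof.
rewrite /riordan_odd /fps_exp /= /fps_mul !subSS !subn0 /=.
rewrite !big_ord_recl !big_ord0 /= /bump /= /fps_one /bit_series.
by case: g0 g1 g2 f1 f2 => [] [] [] [] [].
Qed.

(** When 12 is present, [f1] is read off 23 and [f2] corrects 24.  When it is
    absent, 23 and 34 vanish and 24 is g1 f1, so that [f1] is read off 24. *)
Lemma realize_adjacencies (a12 a13 a14 a23 a24 a34 : bool) :
  a23 ==> a12 -> a34 = a23 -> a24 ==> a12 || a13 ->
  exists g f : fps, f 0 = 0%R /\
    ([/\ riordan_odd g f 2 1 = a12, riordan_odd g f 3 1 = a13
       & riordan_odd g f 4 1 = a14] /\
     [/\ riordan_odd g f 3 2 = a23, riordan_odd g f 4 2 = a24
       & riordan_odd g f 4 3 = a34]).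
Proof.
move=> h23 -> h24.
pose f1 := if a12 then a23 else a24; pose f2 := a24 (+) (a13 && a23).
exists (bit_series [:: a12; a13; a14]), (bit_series [:: false; f1; f2]).
split=> //; have [[-> -> ->] [-> -> ->]] := riordan_odd_bits a12 a13 a14 f1 f2.
by rewrite /f1 /f2 {f1 f2}; move: h23 h24; case: a12 a13 a23 a24 => [] [] [] [].
Qed.

(** * From an order of the vertices to an isomorphism *)

Section Labelling.

Variables (V : finType) (e : rel V).
Hypothesis simple_e : simple_graph e.

Lemma mem_full_uniq (s : seq V) : uniq s -> size s = #|V| -> forall x, x \in s.
Proof.
move=> us ss x; have /card_uniqP cs := us.
by have /subset_cardP/(_ (subset_predT _)) -> : #|s| = #|V| by rewrite cs.
Qed.

Lemma riordan_of_labelling (x0 : V) (s : seq V) (g f : fps) :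
  uniq s -> size s = #|V| -> f 0 = 0%R ->
  (forall i j, i < j -> j < size s ->
     e (nth x0 s i) (nth x0 s j) = riordan_odd g f j.+1 i.+1) ->
  is_riordan_graph e.
Proof.
have [sym_e irr_e] := simple_e; move=> us ss f0 es.
have in_s := mem_full_uniq us ss.
have idx x : index x s < size s by rewrite index_mem.
exists (size s), g, f; split=> //; first exact: leq_ltn_trans (idx x0).
exists (fun x => Ordinal (idx x)).
  exists (fun i : 'I_(size s) => nth x0 s i) => [x | i] /=.
    by rewrite nth_index.
  by apply: val_inj; rewrite /= index_uniq.
move=> x y; rewrite /riordan_graph /=.
rewrite -{1}(nth_index x0 (in_s x)) -{1}(nth_index x0 (in_s y)).
case: (ltngtP (index x s) (index y s)) => [lt_xy | lt_yx | eq_xy] /=.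
- exact: es.
- by rewrite orbF sym_e; apply: es.
- by rewrite eq_xy irr_e.
Qed.

(** * Good orders *)

(** The conditions under which [realize_adjacencies] solves for g and f when
    a, b, c, d are labelled 1, 2, 3, 4. *)
Definition riordan_order (a b c d : V) : bool :=
  [&& e b c ==> e a b, e c d == e b c & e b d ==> e a b || e a c].

Lemma complete_listing (s : seq V) :
  uniq s -> exists2 t, uniq (s ++ t) & size (s ++ t) = #|V|.
Proof.
move=> us; exists (enum [predC s]).
  rewrite cat_uniq us enum_uniq andbT; apply/hasPn=> x.
  by rewrite mem_enum inE.
by rewrite size_cat -cardE -(card_uniqP us) cardC.
Qed.

(** Stated with counts, so that for two explicit lists with the same entries
    the side condition is linear arithmetic. *)
Lemma uniq_reorder (s t : seq V) :
  uniq s -> (forall P, count P t = count P s) -> uniq t.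
Proof. by move=> us st; rewrite (perm_uniq (s2 := s)) //; apply/permP. Qed.

(** A vertex [v] with no neighbour but possibly [u] goes third.  The order
    u, p, v, q of the vertices is good unless 24 = pq is an edge and neither
    12 = up nor 13 = uv is one; in this case v is isolated, and the edge pq can
    be put first. *)
Lemma riordan_order_small_degree (v u : V) :
  #|V| = 4 -> v != u -> (forall w, w != u -> ~~ e v w) ->
  exists a b c d, uniq [:: a; b; c; d] /\ riordan_order a b c d.
Proof.
have [sym_e _] := simple_e; move=> V4 vu small_v.
have [|t] := @complete_listing [:: v; u]; first by rewrite /= inE vu.
rewrite V4; case: t => [|p [|q [|? ?]]] // us _.
have [pu qu] : p != u /\ q != u.
  move: us; rewrite /= !inE !negb_or => /and4P[_ /andP[up uq] _ _].
  by rewrite ![_ == u]eq_sym.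
have vp := negbTE (small_v p pu); have vq := negbTE (small_v q qu).
have [good | ] := boolP (e u v || ~~ e p q).
  exists u, p, v, q; split; first by apply: (uniq_reorder us) => P /=; lia.
  rewrite /riordan_order (sym_e p v) vp vq /=.
  by case: (e p q) good => //=; rewrite orbF => ->; rewrite orbT.
rewrite negb_or negbK => /andP[uv pq].
exists p, q, v, u; split; first by apply: (uniq_reorder us) => P /=; lia.
by rewrite /riordan_order (sym_e q v) vq (sym_e v u) (negbTE uv) pq /= implybT.
Qed.

(** The case of four vertices of Dirac's theorem, for a path; the hypothesis
    says that every degree is at least 2, as no single vertex u exhausts the
    neighbours of v.  Extend a path x, y, z by the last
    vertex w: if x is adjacent to w, then w, x, y, z is a path; otherwise x is
    adjacent to z, so x, y, z is a triangle, which w can enter at y or at z. *)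
Lemma hamiltonian_path4 :
  #|V| = 4 -> (forall v u, v != u -> exists2 w, w != u & e v w) ->
  exists a b c d, [/\ uniq [:: a; b; c; d], e a b, e b c & e c d].
Proof.
have [sym_e irr_e] := simple_e; move=> V4 deg2.
have adj_neq a b : e a b -> a != b.
  by apply: contraTneq => ->; rewrite irr_e.
have [x [y xy]] : exists x y, e x y.
  have [//|t] := @complete_listing [::].
  rewrite V4; case: t => [|x [|u t]] //= /andP[]; rewrite inE negb_or.
  by case/andP=> xu _ _ _; have [y _ xy] := deg2 x u xu; exists x, y.
have yx : e y x by rewrite sym_e.
have [z zx yz] := deg2 y x (adj_neq _ _ yx).
have [|t] := @complete_listing [:: x; y; z].
  by rewrite /= !inE negb_or (eq_sym x z) zx !adj_neq.
rewrite V4; case: t => [|w [|? ?]] // us _.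
have all4 : forall k, k \in [:: x; y; z; w].
  by apply: mem_full_uniq; rewrite ?V4.
have [k ky xk] := deg2 x y (adj_neq _ _ xy).
have /orP[/eqP kz | /eqP kw] : (k == z) || (k == w).
- by have := all4 k; rewrite !inE (negbTE ky) eq_sym (negbTE (adj_neq _ _ xk)).
- rewrite {k ky}kz in xk.
  have wx : w != x.
    by move: us; rewrite /= !inE !negb_or (eq_sym w) => /and3P[/and3P[]].
  have [k kx wk] := deg2 w x wx.
  have /orP[/eqP ky | /eqP kz] : (k == y) || (k == z).
  + have := all4 k; rewrite !inE (negbTE kx) (eq_sym k w).
    by rewrite (negbTE (adj_neq _ _ wk)) orbF.
  + rewrite ky in wk; exists w, y, x, z; split=> //.
    by apply: (uniq_reorder us) => P /=; lia.
  + rewrite kz in wk; exists w, z, x, y; split=> //; last by rewrite sym_e.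
    by apply: (uniq_reorder us) => P /=; lia.
- rewrite kw in xk; exists w, x, y, z; split=> //; last by rewrite sym_e.
  by apply: (uniq_reorder us) => P /=; lia.
Qed.

Lemma riordan_order_exists :
  #|V| = 4 -> exists a b c d, uniq [:: a; b; c; d] /\ riordan_order a b c d.
Proof.
move=> V4.
have [/existsP[v /existsP[u /andP[vu /forallP small_v]]] | no_small] :=
  boolP [exists v, exists u, (v != u) && [forall w, (w != u) ==> ~~ e v w]].
  by apply: (riordan_order_small_degree V4 vu) => w; apply/implyP.
have [|a [b [c [d [us ab bc cd]]]]] := hamiltonian_path4 V4.
  move=> v u vu; have /existsPn/(_ v)/existsPn/(_ u) := no_small.
  rewrite vu /= => /forallPn[w]; rewrite negb_imply negbK => /andP[wu vw].
  by exists w.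
by exists a, b, c, d; rewrite /riordan_order ab bc cd /= implybT.
Qed.

(** * Graphs by number of vertices *)

Lemma riordan4 : #|V| = 4 -> is_riordan_graph e.
Proof.
move=> V4; have [a [b [c [d [us /and3P[h23 /eqP h34 h24]]]]]] :=
  riordan_order_exists V4.
have [g [f [f0 [[g12 g13 g14] [g23 g24 g34]]]]] :=
  @realize_adjacencies (e a b) (e a c) (e a d) (e b c) (e b d) (e c d)
    h23 h34 h24.
apply: (@riordan_of_labelling a [:: a; b; c; d] g f us) => //.
by case=> [|[|[|i]]] [|[|[|[|j]]]].
Qed.

(** The adjacencies of a missing fourth vertex are free; taking 14 and 24
    absent and 34 equal to 23 leaves only the condition that 23 implies 12. *)
Lemma riordan3 : #|V| = 3 -> is_riordan_graph e.
Proof.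
move=> V3.
have [a [b [c [us h23]]]] :
    exists a b c, uniq [:: a; b; c] /\ (e b c ==> e a b).
  (* If bc is an edge and ab is not, the order b, c, a starts with an edge. *)
  have [//|t] := @complete_listing [::].
  rewrite V3; case: t => [|a [|b [|c [|? ?]]]] // us _.
  have [h23 | h23] := boolP (e b c ==> e a b); first by exists a, b, c.
  exists b, c, a; split; first by apply: (uniq_reorder us) => P /=; lia.
  by move: h23; rewrite negb_imply => /andP[-> _]; rewrite implybT.
have [g [f [f0 [[g12 g13 _] [g23 _ _]]]]] :=
  @realize_adjacencies (e a b) (e a c) false (e b c) false (e b c)
    h23 erefl isT.
apply: (@riordan_of_labelling a [:: a; b; c] g f us) => //.
by case=> [|[|i]] [|[|[|j]]].
Qed.

Lemma riordan_le2 : 1 <= #|V| <= 2 -> is_riordan_graph e.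
Proof.
have [//|t /= us ss] := @complete_listing [::].
rewrite -ss; case: t us ss => [|a t] // us ss t2.
(* For a single vertex t is empty, and the default a stands for a second one. *)
have [g [f [f0 [[g12 _ _] _]]]] :=
  @realize_adjacencies (e a (nth a t 0)) false false false false false
    isT erefl isT.
apply: (@riordan_of_labelling a (a :: t) g f us) => //.
by case: t t2 {us ss} g12 => [|b [|? ?]] // _ g12 [|i] // [|[|j]].
Qed.

End Labelling.

Theorem theorem2p12 (V : finType) (e : rel V) (hsimple : simple_graph e)
    (hpos : 1 <= #|V|) (hcard : #|V| <= 4) :
  is_riordan_graph e.
Proof.
have [V2 | V3] := leqP #|V| 2; first by apply: riordan_le2; rewrite ?hpos.
have [V4 | V4] := leqP #|V| 3; first by apply: riordan3 => //; lia.
by apply: riordan4 => //; lia.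
Qed.
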